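(* Let $\Gamma$ be a connected simple graph on the vertex set $[n]$ and let $k\ge 1$ be an integer. The following are equivalent: 1) The graph $\Gamma$ is $k$-connected. 2) For all $d<k$, the symmetric function $\mathbf{ch}(\mathrm{L}_\Gamma)_d$ corresponds to a trivial representation (that is, $S_n$ acts trivially on the degree-$d$ piece of $\mathrm{L}_\Gamma$). 3) For all $d<k$, the $d$-th graded piece $\mathcal{M}_\Gamma^d$ is isomorphic (as a $\mathbb{C}$-vector space) to the $d$-th graded piece $\mathcal{M}_{K_n}^d$, where $K_n$ is the complete graph on $[n]$.
   Context: Graphs are finite, undirected, without loops or multiple edges; $[n]=\{1,\dots,n\}$. A graph $\Gamma=(V,E)$ is $k$-connected if the induced subgraph $\Gamma\setminus A$ on $V\setminus A$ is connected for all $A\subset V$ with $|A|\le k-1$; in other words, there is no set $A$ of fewer than $k$ vertices such that $\Gamma\setminus A$ is disconnected (the empty graph is not regarded as disconnected). An edge $(i,j)$ of a graph on $[n]$ is identified with the transposition $(i,j)\in S_n$. Write $\mathbb{C}[t_\bullet]=\mathbb{C}[t_1,\dots,t_n]$; $w\in S_n$ acts on it by $(wf)(t_1,\dots,t_n)=f(t_{w(1)},\dots,t_{w(n)})$. Ring of splines: $\mathcal{M}_\Gamma$ is the set of functions $\bar\rho\colon S_n\to\mathbb{C}[t_\bullet]$ such that $\bar\rho(w)-\bar\rho(w(i,j))\in\langle t_{w(i)}-t_{w(j)}\rangle$ for all $w\in S_n$ and $(i,j)\in E(\Gamma)$, with pointwise operations. It is graded: $\mathcal{M}_\Gamma^d$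 consists of the splines all of whose values are homogeneous of degree $d$ (or zero). $S_n$ acts by the dot action $(w\cdot\bar\rho)(v)=w\,\bar\rho(w^{-1}v)$. Let $\bar t_i\in\mathcal{M}_\Gamma$ be the constant function $\bar t_i(w)=t_i$, and $\mathrm{L}_\Gamma=\mathcal{M}_\Gamma/\langle\bar t_1,\dots,\bar t_n\rangle$, a finite-dimensional graded $\mathbb{C}$-vector space carrying the induced graded $S_n$-representation; $\mathbf{ch}(\mathrm{L}_\Gamma)_d$ is the Frobenius characteristic of its degree-$d$ piece. ''Trivial representation'' means that every group element acts as the identity (any multiplicity is allowed). *)

(* Defs.v *)
From HB Require Import structures.
From mathcomp Require Import all_boot all_order all_fingroup all_algebra.
From mathcomp Require Import boolp reals complex mpoly.

Set Implicit Arguments.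
Unset Strict Implicit.
Unset Printing Implicit Defensive.

Import GRing.Theory.
Local Open Scope ring_scope.
Local Open Scope quotient_scope.

Record sgraph (n : nat) := SGraph {
  adj :> rel 'I_n;
  adj_sym : ssrbool.symmetric adj;
  adj_irr : irreflexive adj }.

Section CompleteGraph.
Variable n : nat.
Definition complete_adj : rel 'I_n := [rel x y | x != y].
Lemma complete_adj_sym : ssrbool.symmetric complete_adj.
Proof. by move=> x y; rewrite /complete_adj /= eq_sym. Qed.
Lemma complete_adj_irr : irreflexive complete_adj.
Proof. by move=> x; rewrite /complete_adj /= eqxx. Qed.
Definition complete_graph := SGraph complete_adj_sym complete_adj_irr.
End CompleteGraph.

(* [connected_off G A]: the subgraph induced on the complement of A is
   connected; the empty graph counts as connected. *)
Definition connected_off n (G : sgraph n) (A : {set 'I_n}) : Prop :=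
  {in ~: A &, forall x y,
     connect [rel u v | [&& u \notin A, v \notin A & G u v]] x y}.

Definition connected_graph n (G : sgraph n) : Prop := connected_off G set0.

Definition k_connected n (G : sgraph n) (k : nat) : Prop :=
  forall A : {set 'I_n}, (#|A| < k)%N -> connected_off G A.

(* [pcomp u v] is the composite u o v (v is applied first), the usual product
   of the symmetric group; the product of [{perm T}] is in the other order. *)
Definition pcomp n (u v : 'S_n) : 'S_n := (v * u)%g.

Lemma pcompE n (u v : 'S_n) i : pcomp u v i = u (v i).
Proof. exact: permM. Qed.

Lemma pcompA n (u v w : 'S_n) : pcomp u (pcomp v w) = pcomp (pcomp u v) w.
Proof. by rewrite /pcomp mulgA. Qed.

Definition principal_ideal (A : comNzRingType) (f : A) : {pred A} :=
  fun p => `[< exists q, p = q * f >].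

Section Splines.
Variables (F : comNzRingType) (n : nat).
Local Notation P := {mpoly F[n]}.
Local Notation funS := {ffun 'S_n -> P}.

Section Graph.
Variable G : sgraph n.

Definition is_spline : {pred funS} := fun rho =>
  [forall w : 'S_n, forall i, forall j, G i j ==>
    (rho w - rho (pcomp w (tperm i j))
       \in principal_ideal ('X_(w i) - 'X_(w j)))].

Lemma is_splineP (rho : funS) :
  reflect (forall (w : 'S_n) i j, G i j -> exists q : P,
             rho w - rho (pcomp w (tperm i j)) = q * ('X_(w i) - 'X_(w j)))
          (rho \in is_spline).
Proof.
apply: (iffP forallP) => [h w i j Gij | h w].
  by have /forallP/(_ i)/forallP/(_ j)/implyP/(_ Gij)/asboolP := h w.
apply/forallP => i; apply/forallP => j; apply/implyP => Gij.
by apply/asboolP; exact: h.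
Qed.

Lemma is_spline_submod : submod_closed is_spline.
Proof.
split=> [|a x y /is_splineP hx /is_splineP hy]; apply/is_splineP => w i j Gij.
  by exists 0; rewrite !ffunE subrr mul0r.
have [[p hp] [q hq]] := (hx w i j Gij, hy w i j Gij).
exists (a *: p + q); rewrite !ffunE mulrDl -scalerAl -hp -hq.
by rewrite scalerBr opprD addrACA.
Qed.

Lemma is_spline_mulr : mulr_closed is_spline.
Proof.
split=> [|x y /is_splineP hx /is_splineP hy]; apply/is_splineP => w i j Gij.
  by exists 0; rewrite !ffunE subrr mul0r.
have [[p hp] [q hq]] := (hx w i j Gij, hy w i j Gij).
set v := pcomp w _ in hp hq *.
exists (p * y w + x v * q); rewrite !ffunE mulrDl mulrAC -hp -mulrA -hq.
by rewrite mulrBl mulrBr addrA subrK.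
Qed.

HB.instance Definition _ :=
  GRing.isSubmodClosed.Build F funS is_spline is_spline_submod.
HB.instance Definition _ :=
  GRing.isMulClosed.Build funS is_spline is_spline_mulr.

Record spline := Spline {
  spline_val :> {ffun 'S_n -> {mpoly F[n]}};
  spline_valP : spline_val \in is_spline }.

HB.instance Definition _ := [isSub for spline_val].
HB.instance Definition _ := [Choice of spline by <:].
HB.instance Definition _ := [SubChoice_isSubZmodule of spline by <:].
HB.instance Definition _ := 
  GRing.SubZmodule_isSubPzRing.Build _ _ spline (GRing.subringClosedP is_spline).
HB.instance Definition _ := [SubZmodule_isSubLmodule of spline by <:].

Lemma spline_mulC : commutative (@GRing.mul spline).
Proof.
by move=> x y; apply/val_inj; rewrite !rmorphM; apply/ffunP => w;
   rewrite !ffunE mulrC.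
Qed.
HB.instance Definition _ :=
  GRing.PzRing_hasCommutativeMul.Build spline spline_mulC.

Definition homog_spline (d : nat) : {pred spline} :=
  fun rho => [forall w, rho w \is d.-homog].

Lemma homog_spline_submod d : submod_closed (homog_spline d).
Proof.
split=> [|a x y /forallP hx /forallP hy]; apply/forallP => w.
  by rewrite ffunE dhomog0.
by rewrite !ffunE rpredD ?rpredZ.
Qed.
HB.instance Definition _ d :=
  GRing.isSubmodClosed.Build F spline (homog_spline d) (homog_spline_submod d).

Record graded_spline (d : nat) := GradedSpline {
  graded_spline_val :> spline;
  graded_spline_valP : graded_spline_val \in homog_spline d }.

HB.instance Definition _ d := [isSub for @graded_spline_val d].
HB.instance Definition _ d := [Choice of graded_spline d by <:].
HB.instance Definition _ d := [SubChoice_isSubZmodule of graded_spline d by <:].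
HB.instance Definition _ d := [SubZmodule_isSubLmodule of graded_spline d by <:].

(* (w . rho)(v) = w rho(w^-1 v), where [msym w f] is f(t_(w 1), ..., t_(w n)). *)
Definition dot_fun (w : 'S_n) (rho : funS) : funS :=
  [ffun v => msym w (rho (pcomp w^-1%g v))].

Lemma msymU (w : 'S_n) i : msym w ('X_i : P) = 'X_(w i).
Proof. by rewrite /msym mmapX mmap1U. Qed.

Lemma dot_spline_subproof w (rho : spline) : dot_fun w rho \in is_spline.
Proof.
apply/is_splineP => v i j Gij.
have /is_splineP/(_ (pcomp w^-1%g v) i j Gij)[q hq] := spline_valP rho.
exists (msym w q); rewrite !ffunE -raddfB /= pcompA hq rmorphM raddfB /=.
by rewrite !msymU !pcompE !permKV.
Qed.

Definition dot (w : 'S_n) (rho : spline) : spline :=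
  Spline (dot_spline_subproof w rho).

Lemma const_spline_subproof (p : P) : ([ffun _ => p] : funS) \in is_spline.
Proof.
by apply/is_splineP => w i j _; exists 0; rewrite !ffunE subrr mul0r.
Qed.

Definition tbar (i : 'I_n) : spline := Spline (const_spline_subproof 'X_i).

(* The ideal of the (commutative) ring of splines generated by the tbar i. *)
Definition tideal : {pred spline} :=
  fun rho => `[< exists c : 'I_n -> spline, rho = \sum_i c i * tbar i >].

Lemma tideal_zmod : zmod_closed tideal.
Proof.
split=> [|x y /asboolP[c ->] /asboolP[e ->]]; apply/asboolP.
  by exists (fun=> 0); rewrite big1 // => i _; rewrite mul0r.
exists (fun i => c i - e i); rewrite -sumrB.
by apply: eq_bigr => i _; rewrite mulrBl.
Qed.
HB.instance Definition _ := GRing.isZmodClosed.Build spline tideal tideal_zmod.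

Lemma spline_scalerAl (a : F) (x y : spline) : a *: (x * y) = a *: x * y.
Proof.
by apply/val_inj/ffunP => w; rewrite !(linearZ, rmorphM) /= !ffunE scalerAl.
Qed.

Lemma tideal_scale a x : x \in tideal -> a *: x \in tideal.
Proof.
move=> /asboolP[c ->]; apply/asboolP; exists (fun i => a *: c i).
by rewrite scaler_sumr; apply: eq_bigr => i _; rewrite spline_scalerAl.
Qed.

Lemma dot_is_zmod_morphism w : zmod_morphism (dot w).
Proof.
by move=> x y; apply/val_inj/ffunP => v; rewrite !ffunE raddfB.
Qed.
HB.instance Definition _ w :=
  GRing.isZmodMorphism.Build spline spline (dot w) (dot_is_zmod_morphism w).

Lemma dot_scalable w : scalable (dot w).
Proof. by move=> a x; apply/val_inj/ffunP => v; rewrite !ffunE linearZ. Qed.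
HB.instance Definition _ w :=
  GRing.isScalable.Build F spline spline *:%R (dot w) (@dot_scalable w).

Lemma dotM w x y : dot w (x * y) = dot w x * dot w y.
Proof. by apply/val_inj/ffunP => v; rewrite !ffunE rmorphM. Qed.

Lemma dot_tbar w i : dot w (tbar i) = tbar (w i).
Proof. by apply/val_inj/ffunP => v; rewrite !ffunE msymU. Qed.

Lemma dot1 x : dot 1%g x = x.
Proof.
by apply/val_inj/ffunP => v; rewrite !ffunE /pcomp invg1 mulg1 msym1m.
Qed.

Lemma dot_pcomp u w x : dot (pcomp u w) x = dot u (dot w x).
Proof.
by apply/val_inj/ffunP => v; rewrite !ffunE /pcomp invMg !mulgA msymMm.
Qed.

Lemma tideal_dot w x : x \in tideal -> dot w x \in tideal.
Proof.
move=> /asboolP[c ->]; apply/asboolP.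
exists (fun i => dot w (c ((w^-1)%g i))); rewrite raddf_sum /=.
rewrite [RHS](reindex_inj (@perm_inj _ w)) /=.
by apply: eq_bigr => i _; rewrite dotM dot_tbar permK.
Qed.

Definition Lquot : Type := {ideal_quot tideal}.
HB.instance Definition _ := GRing.Zmodule.on Lquot.

Definition Lpi (x : spline) : Lquot := \pi_{ideal_quot tideal} x.

Definition Lrepr (x : Lquot) : spline :=
  generic_quotient.repr (x : {ideal_quot tideal}).

Lemma Lpi_eq x y : (Lpi x == Lpi y) = (x - y \in tideal).
Proof. by rewrite Quotient.idealrBE. Qed.

Lemma Lpi_repr (x : Lquot) : Lpi (Lrepr x) = x.
Proof. exact: reprK. Qed.

Lemma LpiD x y : Lpi (x + y) = Lpi x + Lpi y.
Proof. exact: (raddfD \pi_{ideal_quot tideal}). Qed.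

Definition Lscale (a : F) (x : Lquot) : Lquot :=
  Lpi (a *: Lrepr x).

Lemma LscaleE a x : Lscale a (Lpi x) = Lpi (a *: x).
Proof.
apply/eqP; rewrite Lpi_eq -scalerBr tideal_scale // -Lpi_eq.
by rewrite Lpi_repr.
Qed.

Lemma LscaleA a b v : Lscale a (Lscale b v) = Lscale (a * b) v.
Proof. by rewrite -[v]Lpi_repr !LscaleE scalerA. Qed.
Lemma Lscale1 : left_id 1 Lscale.
Proof. by move=> v; rewrite -[v]Lpi_repr LscaleE scale1r. Qed.
Lemma LscaleDr : right_distributive Lscale +%R.
Proof.
move=> a u v; rewrite -[u]Lpi_repr -[v]Lpi_repr.
by rewrite -LpiD !LscaleE scalerDr LpiD.
Qed.
Lemma LscaleDl v : {morph Lscale^~ v : a b / a + b}.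
Proof. by move=> a b; rewrite -[v]Lpi_repr !LscaleE scalerDl LpiD. Qed.
HB.instance Definition _ := GRing.Zmodule_isLmodule.Build F Lquot
  LscaleA Lscale1 LscaleDr LscaleDl.

(* The degree-d piece of the quotient is the image of the degree-d splines. *)
Definition Lquot_deg (d : nat) (x : Lquot) : Prop :=
  exists2 rho : spline, rho \in homog_spline d & x = Lpi rho.

Definition Ldot (w : 'S_n) (x : Lquot) : Lquot :=
  Lpi (dot w (Lrepr x)).

Lemma LdotE w rho : Ldot w (Lpi rho) = Lpi (dot w rho).
Proof.
apply/eqP; rewrite Lpi_eq -raddfB tideal_dot // -Lpi_eq.
by rewrite Lpi_repr.
Qed.

Lemma Ldot1 x : Ldot 1%g x = x.
Proof. by rewrite -[x]Lpi_repr LdotE dot1. Qed.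

Lemma Ldot_pcomp u w x : Ldot (pcomp u w) x = Ldot u (Ldot w x).
Proof. by rewrite -[x]Lpi_repr !LdotE dot_pcomp. Qed.

Definition L_trivial_rep (d : nat) : Prop :=
  forall (w : 'S_n) (x : Lquot), Lquot_deg d x -> Ldot w x = x.

End Graph.
End Splines.

Arguments graded_spline F {n} G d.
Arguments L_trivial_rep F {n} G d.

Definition isomorphic_lmod (F : nzRingType) (U V : lmodType F) : Prop :=
  exists f : {linear U -> V}, bijective f.

(* Main.v *)
(* If [G] is k-connected and [rho] is a spline of degree d < k, then [rho] is a
   spline on the complete graph: modulo [t_(w i) - t_(w j)] and after translating
   [t_(w i)] to the origin, following a path from i to j shows that each monomial
   of [rho w - rho (w (i,j))] involves a vertex of the path, so its support is a
   vertex cut of size at most d, which is impossible.  On splines of the complete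
   graph a transposition s = (a,b) acts by [s rho - rho = (t_a - t_b) eta] with
   [eta] a spline, hence trivially modulo the [t_i].  Conversely, if A cuts off B
   then [rho_p w = prod_(a in A) (t_(w a) - t_p)] for [w^-1 p \in B], and 0
   otherwise, is a spline of degree #|A| on [G] but not on the complete graph;
   with A of minimal size, [rho_a - rho_x] (a in A, x in B) is not in the ideal of
   the [t_i], since in lower degree all splines live on the complete graph. *)

From HB Require Import structures.
From mathcomp Require Import all_boot all_order all_fingroup all_algebra.
From mathcomp Require Import boolp reals complex mpoly.
Require Import Defs.

Set Implicit Arguments.
Unset Strict Implicit.
Unset Printing Implicit Defensive.

Import GRing.Theory.
Local Open Scope ring_scope.

(** * Substitution endomorphisms of the polynomial ring *)

Section Substitution.
Variables (F : comNzRingType) (n : nat).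
Local Notation P := {mpoly F[n]}.

Lemma lrmorph_mpolyX (phi : {lrmorphism P -> P}) (m : 'X_{1..n}) :
  phi 'X_[m] = \prod_i phi 'X_i ^+ m i.
Proof.
by rewrite mpolyXE_id rmorph_prod; apply: eq_bigr => i _; rewrite rmorphXn.
Qed.

(** Congruence modulo [l] respects scalars, sums and products, so it spreads from the variables to
    all polynomials. *)
Lemma mpoly_congr_lrmorph (phi : {lrmorphism P -> P}) (l : P) :
  (forall i, exists q, phi 'X_i - 'X_i = q * l) ->
  forall p, exists q, phi p - p = q * l.
Proof.
move=> hX.
have hM (a b : P) : (exists q, phi a - a = q * l) ->
    (exists q, phi b - b = q * l) -> exists q, phi (a * b) - a * b = q * l.
  move=> [u hu] [v hv]; exists (phi a * v + u * b).
  rewrite mulrDl -(mulrA _ v) -hv (mulrAC u) -hu rmorphM mulrBr mulrBl.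
  by rewrite addrA subrK.
elim/mpolyind => [|c m p _ _ [q hq]].
  by exists 0; rewrite raddf0 subrr mul0r.
have [r hr] : exists r, phi 'X_[m] - 'X_[m] = r * l.
  rewrite mpolyXE_id.
  apply: (big_ind (fun a => exists r, phi a - a = r * l)) => //.
    by exists 0; rewrite rmorph1 subrr mul0r.
  move=> i _; elim: (m i) => [|e IHe]; last by rewrite exprS; exact: hM.
  by exists 0; rewrite expr0 rmorph1 subrr mul0r.
exists (c *: r + q); rewrite mulrDl -scalerAl -hr -hq raddfD /= linearZ /=.
by rewrite scalerBr opprD addrACA.
Qed.

Lemma lrmorph_dhomog (phi : {lrmorphism P -> P}) :
  (forall i, phi 'X_i \is 1.-homog) ->
  forall d p, p \is d.-homog -> phi p \is d.-homog.
Proof.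
move=> hX d p /dhomogP hp; rewrite [p]mpolyE linear_sum /=.
rewrite big_seq; apply: rpred_sum => m /hp <-; rewrite linearZ /=; apply: rpredZ.
rewrite lrmorph_mpolyX mdegE.
apply: (big_ind2 (fun a e => a \is e.-homog)) => [|a e b f|i _].
- exact: dhomog1.
- exact: dhomogM.
- by rewrite -[X in X.-homog]mul1n; apply: dhomogMn.
Qed.

Definition mpoly_subst (h : 'I_n -> P) : P -> P :=
  comp_mpoly [tuple h i | i < n].
HB.instance Definition _ h := GRing.LRMorphism.on (mpoly_subst h).

Lemma mpoly_substX h i : mpoly_subst h 'X_i = h i.
Proof. by rewrite /mpoly_subst comp_mpolyXU -tnth_nth tnth_mktuple. Qed.

Definition kill_vars (S : {set 'I_n}) : P -> P :=
  mpoly_subst (fun i => if i \in S then 'X_i else 0).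
HB.instance Definition _ S := GRing.LRMorphism.on (kill_vars S).

Lemma kill_varsX (S : {set 'I_n}) i :
  kill_vars S 'X_i = if i \in S then 'X_i else 0.
Proof. exact: mpoly_substX. Qed.

(** The substitution kills every monomial containing a variable outside [S] and fixes all the
    others. *)
Lemma mcoeff_kill_vars (S : {set 'I_n}) (p : P) (m : 'X_{1..n}) :
  (forall i, m i != 0%N -> i \in S) -> (kill_vars S p)@_m = p@_m.
Proof.
move=> hm; elim/mpolyind: p => [|c m' p _ _ IHp]; first by rewrite raddf0.
rewrite raddfD /= linearZ /= !mcoeffD !mcoeffZ IHp; congr (_ * _ + _).
have [/existsP[i /andP[iS mi]]|] :=
  boolP [exists i, (i \notin S) && (m' i != 0%N)].
  rewrite lrmorph_mpolyX (bigD1 i) //= kill_varsX (negPf iS).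
  rewrite expr0n (negPf mi) mul0r mcoeff0 mcoeffX.
  by case: eqP => // e; rewrite e in mi; rewrite (hm i mi) in iS.
rewrite negb_exists => /forallP hm'; congr (_@_m).
rewrite lrmorph_mpolyX mpolyXE_id; apply: eq_bigr => i _.
rewrite /= kill_varsX; have := hm' i; case: (i \in S) => //=.
by rewrite negbK => /eqP ->; rewrite !expr0.
Qed.

(** Models reduction modulo ['X_p - 'X_q] by an endomorphism instead of a quotient map, so that the
    spline condition becomes an equation between polynomials. *)
Definition identify (p q : 'I_n) : P -> P :=
  mpoly_subst (fun i => if i == q then 'X_p else 'X_i).
HB.instance Definition _ p q := GRing.LRMorphism.on (identify p q).

Lemma identifyX p q i : identify p q 'X_i = if i == q then 'X_p else 'X_i.
Proof. exact: mpoly_substX. Qed.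

Lemma identify_eqX p q : identify p q 'X_p = identify p q 'X_q.
Proof. by rewrite !identifyX eqxx if_same. Qed.

(** The difference [identify p q f - f] is always a multiple of ['X_p - 'X_q]; on the kernel it
    equals [- f]. *)
Lemma identify_eq0P p q (f : P) :
  (exists g, f = g * ('X_p - 'X_q)) <-> identify p q f = 0.
Proof.
split=> [[g ->]|f0]; first by rewrite rmorphM raddfB /= identify_eqX subrr mulr0.
have [|g hg] := @mpoly_congr_lrmorph (identify p q) ('X_p - 'X_q) _ f.
  move=> i; rewrite /= identifyX; case: (i =P q) => [->|_].
    by exists 1; rewrite mul1r.
  by exists 0; rewrite subrr mul0r.
by exists (- g); rewrite mulNr -hg /= f0 sub0r opprK.
Qed.

Lemma pihomogMX d (p : P) i :
  pihomog mdeg d.+1 (p * 'X_i) = pihomog mdeg d p * 'X_i.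
Proof.
elim/mpolyind: p => [|c m p _ _ IHp]; first by rewrite mul0r !raddf0 mul0r.
rewrite mulrDl !raddfD /= mulrDl IHp -scalerAl !linearZ /= -scalerAl.
congr (_ *: _ + _); rewrite -mpolyXD !pihomogX /= mdegD mdeg1 addn1 eqSS.
by case: ifP => _; rewrite ?mul0r // mpolyXD.
Qed.

End Substitution.

(** * The spline condition under identification of variables, and splines of low degree *)

Section PolynomialSplines.
Variables (F : idomainType) (n : nat).
Local Notation P := {mpoly F[n]}.
Local Notation funS := {ffun 'S_n -> P}.
Local Notation K := (complete_graph n).

Lemma mpolyXU_inj (i j : 'I_n) : 'X_i = 'X_j :> P -> i = j.
Proof.
move=> /(congr1 (mcoeff U_(i))); rewrite !mcoeffXU eqxx.
by case: (j =P i) => [->|_] // /eqP; rewrite mulr1n oner_eq0.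
Qed.

Lemma is_spline_identifyP (G : sgraph n) (rho : funS) :
  (forall (w : 'S_n) i j, G i j -> identify (w i) (w j) (rho w) =
                          identify (w i) (w j) (rho (pcomp w (tperm i j))))
  <-> rho \in is_spline G.
Proof.
split=> [h|/is_splineP h w i j Gij].
  apply/is_splineP => w i j Gij; apply/identify_eq0P.
  by rewrite raddfB /= h ?subrr.
by apply/eqP; rewrite -subr_eq0 -raddfB; apply/eqP/identify_eq0P/h.
Qed.

Lemma is_spline_complete (G : sgraph n) (rho : funS) :
  rho \in is_spline K -> rho \in is_spline G.
Proof.
move=> /is_splineP h; apply/is_splineP => w i j Gij; apply: h => /=.
by apply: contraTneq Gij => ->; rewrite adj_irr.
Qed.

Lemma pcomp1 (w : 'S_n) : pcomp w 1%g = w.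
Proof. exact: mul1g. Qed.

(** Since [phi] merges all ['X_(w z)] with [z] outside [A], crossing an edge that avoids [A] does
    not change [phi (rho w)], and the merging persists at the new permutation. The transposition of
    [x] and [y] is a product of such edge transpositions along the path. *)
Lemma spline_collapse (G : sgraph n) (rho : funS) (A : {set 'I_n})
    (phi : {rmorphism P -> P}) (c : P) (x y : 'I_n) (w : 'S_n) :
  rho \in is_spline G ->
  connect [rel u v | [&& u \notin A, v \notin A & G u v]] x y ->
  x \notin A ->
  (forall z, z \notin A -> phi 'X_(w z) = c) ->
  phi (rho w) = phi (rho (pcomp w (tperm x y))).
Proof.
move=> /is_splineP rhoG /connectP[s].
pose good (v : 'S_n) := forall z, z \notin A -> phi 'X_(v z) = c.
have good_tperm v a b : a \notin A -> b \notin A -> good v ->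
    good (pcomp v (tperm a b)).
  by move=> aA bA gv z zA; rewrite pcompE; case: tpermP => *; apply: gv.
have edge v a b : a \notin A -> b \notin A -> G a b -> good v ->
    phi (rho v) = phi (rho (pcomp v (tperm a b))).
  move=> aA bA Gab gv; have [q hq] := rhoG v a b Gab; apply/eqP.
  by rewrite -subr_eq0 -raddfB hq /= rmorphM raddfB /= !gv // subrr mulr0.
elim: s x w => [|z s IHs] x w /= => [_ ->|]; first by rewrite tperm1 pcomp1.
move=> /andP[/and3P[xA zA Gxz] s_path] y_last _ gw.
have yA : y \notin A.
  rewrite y_last; elim: (s) (z) zA s_path => //= b t IHt a _.
  by case/andP=> /and3P[_ bA _]; exact: IHt.
have [<-|nxy] := eqVneq x y; first by rewrite tperm1 pcomp1.
have [eyz|nyz] := eqVneq y z; first by rewrite eyz; exact: edge.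
(* The first edge is crossed twice, and the induction hypothesis handles the rest of the path in
   between. *)
have -> : tperm x y = (tperm x z * tperm z y * tperm x z)%g.
  have := tpermJ z y (tperm x z); rewrite tpermR tpermD // 1?eq_sym // => <-.
  by rewrite conjgE tpermV mulgA.
have -> : pcomp w (tperm x z * tperm z y * tperm x z)%g =
  pcomp (pcomp (pcomp w (tperm x z)) (tperm z y)) (tperm x z).
  by rewrite /pcomp !mulgA.
rewrite -edge //; last by do 2!apply: (good_tperm) => //.
by rewrite -IHs //; [exact: edge|exact: good_tperm].
Qed.

Lemma low_degree_is_spline_complete (G : sgraph n) k d (rho : funS) :
  k_connected G k -> (d < k)%N -> (forall w, rho w \is d.-homog) ->
  rho \in is_spline G -> rho \in is_spline K.
Proof.
move=> kG ltdk hrho rhoG; apply/is_spline_identifyP => w i j nij.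
set p := w i; set q := w j; pose f := rho w - rho (pcomp w (tperm i j)).
suff: identify p q f = 0 by rewrite raddfB /= => /eqP; rewrite subr_eq0 => /eqP.
(* [sigma] identifies ['X_q] with ['X_p] and translates the other variables so that ['X_p] plays the
   role of the origin. *)
pose sigma : {lrmorphism P -> P} :=
  mpoly_subst (fun l => if (l == p) || (l == q) then 'X_p else 'X_l + 'X_p).
have sigmaX l : sigma 'X_l = if (l == p) || (l == q) then 'X_p else 'X_l + 'X_p.
  exact: mpoly_substX.
(* [unsigma] undoes the translation: the composite acts as [identify p q], so it is enough that
   [sigma f] vanishes. *)
pose unsigma : {lrmorphism P -> P} :=
  mpoly_subst (fun l => if l == p then 'X_p else 'X_l - 'X_p).
have unsigmaX l : unsigma 'X_l = if l == p then 'X_p else 'X_l - 'X_p.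
  exact: mpoly_substX.
suff sf0 : sigma f = 0.
  pose tau : {lrmorphism P -> P} := unsigma \o sigma.
  have tauE g : tau g = unsigma (sigma g) by [].
  apply/identify_eq0P.
  have [|g hg] := @mpoly_congr_lrmorph _ _ tau ('X_p - 'X_q) _ f.
    move=> l; rewrite tauE sigmaX.
    have [->|nlp] := eqVneq l p.
      by exists 0; rewrite /= unsigmaX eqxx subrr mul0r.
    have [->|nlq] := eqVneq l q.
      by exists 1; rewrite /= unsigmaX eqxx mul1r.
    exists 0; rewrite /= raddfD /= !unsigmaX eqxx (negPf nlp).
    by rewrite subrK subrr mul0r.
  by exists (- g); rewrite mulNr -hg tauE sf0 raddf0 sub0r opprK.
have sf_homog : sigma f \is d.-homog.
  apply: lrmorph_dhomog => [l|]; last by rewrite rpredB ?hrho.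
  have hX (a : 'I_n) : ('X_a : P) \is 1.-homog by rewrite dhomogX /= mdeg1.
  by rewrite sigmaX; case: ifP => _; rewrite ?rpredD ?hX.
apply/mpolyP => m; rewrite mcoeff0.
have [md|nmd] := eqVneq (mdeg m) d; last exact: dhomog_nemf_coeff sf_homog nmd.
(* The support of [m] apart from [p] and [q] has at most [mdeg m = d] elements. Its preimage [A]
   under [w] has fewer than [k] vertices and avoids [i] and [j], so [i] and [j] stay connected off
   [A]. *)
pose L := [set l | [&& m l != 0%N, l != p & l != q]].
have cL : (#|L| <= d)%N.
  rewrite -md mdegE -sum1_card big_mkcond; apply: leq_sum => l _.
  by rewrite !inE; case: (m l) => [|e] //=; case: ifP.
rewrite -(@mcoeff_kill_vars _ _ (p |: (q |: L))); last first.
  by move=> l ml; rewrite !inE ml; do 2!case: eqP => //=.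
pose A := w @^-1: L.
have iA : i \notin A by rewrite !inE eqxx andbF.
have jA : j \notin A by rewrite !inE eqxx !andbF.
have cA : connected_off G A.
  apply: kG; apply: leq_ltn_trans ltdk; apply: leq_trans cL.
  by rewrite card_preimset //; exact: perm_inj.
(* Killing the variables outside [p], [q] and [L] keeps the coefficient of [m] and sends every
   [sigma 'X_(w z)] with [z] outside [A] to ['X_p]. *)
pose phi : {rmorphism P -> P} := kill_vars (p |: (q |: L)) \o sigma.
have phi_rho : phi (rho w) = phi (rho (pcomp w (tperm i j))).
  apply: (spline_collapse (A := A) (c := 'X_p) rhoG _ iA).
    by apply: cA; rewrite inE.
  move=> z; rewrite !inE /phi /= sigmaX -/p -/q.
have [->|nzp] /= := eqVneq (w z) p; first by rewrite kill_varsX !inE eqxx.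
have [->|nzq] /= := eqVneq (w z) q; first by rewrite kill_varsX !inE eqxx.
rewrite !andbT negbK => /eqP mz; rewrite raddfD /= !kill_varsX !inE eqxx /=.
by rewrite mz (negPf nzp) (negPf nzq) add0r.
have -> : kill_vars (p |: (q |: L)) (sigma f) = phi f by [].
by rewrite (rmorphB phi) phi_rho subrr mcoeff0.
Qed.


(** * The dot action on splines of the complete graph *)

Lemma pcomp_tperm (v : 'S_n) i j :
  pcomp (tperm (v i) (v j)) v = pcomp v (tperm i j).
Proof. by rewrite /pcomp -tpermJ conjgE !mulgA mulgV mul1g. Qed.

Lemma msym_tpermK (a b : 'I_n) : involutive (@msym n F (tperm a b)).
Proof. by move=> p; rewrite -msymMm tperm2 msym1m. Qed.

Lemma identify_msym (a b : 'I_n) (p : P) :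
  identify a b (msym (tperm a b) p) = identify a b p.
Proof.
apply/eqP; rewrite -subr_eq0 -raddfB; apply/eqP/identify_eq0P.
apply: (@mpoly_congr_lrmorph _ _ (msym (tperm a b))) => i /=.
rewrite msymU; case: tpermP => [->|->|_ _].
- by exists (-1); rewrite mulN1r opprB.
- by exists 1; rewrite mul1r.
- by exists 0; rewrite subrr mul0r.
Qed.

(** Left multiplication of [v] by the transposition of [a] and [b] is right multiplication by that
    of their preimages under [v], which is an edge of the complete graph. *)
Lemma dot_tperm_congr (rho : funS) (a b : 'I_n) (v : 'S_n) :
  a != b -> rho \in is_spline K ->
  exists q, dot_fun (tperm a b) rho v - rho v = q * ('X_a - 'X_b).
Proof.
move=> nab /is_spline_identifyP rhoK; apply/identify_eq0P.
rewrite raddfB /= ffunE identify_msym tpermV.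
have := rhoK v (v^-1%g a) (v^-1%g b); rewrite -pcomp_tperm !permKV => ->.
  by rewrite subrr.
by rewrite /= /complete_adj /= (inj_eq perm_inj).
Qed.

Lemma spline_divX (rho eta : funS) (a b : 'I_n) :
  a != b -> rho \in is_spline K ->
  (forall v, dot_fun (tperm a b) rho v - rho v = eta v * ('X_a - 'X_b)) ->
  eta \in is_spline K.
Proof.
move=> nab rhoK hD; apply/is_spline_identifyP => v i j nij.
set p := v i; set q := v j; set v' := pcomp v _.
have nX : 'X_a - 'X_b != 0 :> P.
  by rewrite subr_eq0; apply: contra nab => /eqP/mpolyXU_inj ->.
(* If the edge at [v] realises the transposition of [a] and [b], both the difference and
   ['X_a - 'X_b] are anti-invariant under it, so their quotient [eta] is equivariant. *)
have [eab|] := eqVneq (tperm p q) (tperm a b).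
  have v'E : v' = pcomp (tperm a b) v by rewrite -eab pcomp_tperm.
  suff -> : eta v' = msym (tperm p q) (eta v) by rewrite identify_msym.
  apply: (mulIf nX); rewrite -hD eab; apply: oppr_inj.
  have -> : 'X_a - 'X_b = - msym (tperm a b) ('X_a - 'X_b) :> P.
    by rewrite raddfB /= !msymU tpermL tpermR opprB.
  rewrite mulrN opprK -rmorphM -hD /= !ffunE [RHS]raddfB /= msym_tpermK opprB.
  have vK : pcomp (tperm a b) (pcomp (tperm a b) v) = v.
    by rewrite pcompA /pcomp tperm2 mulg1.
  by rewrite tpermV v'E vK.
(* Otherwise [identify p q] does not kill ['X_a - 'X_b], and this factor can be cancelled in the
   spline condition for the difference. *)
move=> nt; have DK : dot_fun (tperm a b) rho - rho \in is_spline K.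
  by rewrite rpredB // (dot_spline_subproof _ (Spline rhoK)).
have /is_spline_identifyP/(_ v i j nij) := DK.
have E u : (dot_fun (tperm a b) rho - rho) u = eta u * ('X_a - 'X_b).
  by rewrite -hD !ffunE.
rewrite !E !rmorphM -/p -/q -/v' /=; apply: mulIf.
rewrite raddfB /= subr_eq0 !identifyX; apply: contra nt => /eqP.
have [eaq|naq] := eqVneq a q; have [ebq|nbq] := eqVneq b q => /mpolyXU_inj.
- by rewrite eaq ebq eqxx in nab.
- by move=> ->; rewrite eaq tpermC.
- by move=> <-; rewrite ebq.
- by move=> eab; rewrite eab eqxx in nab.
Qed.

Lemma mul_tbar_tideal (G : sgraph n) (eta : spline F G) i :
  eta * tbar F G i \in @tideal F n G.
Proof.
apply/asboolP; exists (fun j => if j == i then eta else 0).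
rewrite (bigD1 i) //= eqxx big1 ?addr0 // => j /negPf ->.
by rewrite mul0r.
Qed.

(** Induction on a factorisation of [w] into transpositions. For a single one the difference is [e]
    times [tbar a - tbar b], where [e] is a spline on the complete graph and hence on [G]. *)
Lemma dot_sub_tideal (G : sgraph n) (rho : spline F G) (w : 'S_n) :
  (rho : funS) \in is_spline K -> dot w rho - rho \in @tideal F n G.
Proof.
move=> rhoK; have [ts -> nts] := prod_tpermP w.
elim: ts nts => [|[a b] ts IHts] /=.
  by rewrite big_nil dot1 subrr rpred0.
case/andP=> nab /IHts{}IHts; rewrite big_cons /=.
set u := (\prod_(t <- ts) _)%g in IHts *.
have -> : dot (tperm a b * u)%g rho = dot u (dot (tperm a b) rho).
  by rewrite -dot_pcomp.
have -> : dot u (dot (tperm a b) rho) - rho =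
    dot u (dot (tperm a b) rho - rho) + (dot u rho - rho).
  by rewrite raddfB /= addrA subrK.
apply: rpredD => //; apply: tideal_dot.
have [eta heta] := choice (fun v => dot_tperm_congr v nab rhoK).
have etaK : finfun eta \in is_spline K.
  by apply: (spline_divX nab rhoK) => v; rewrite heta ffunE.
pose e := Spline (is_spline_complete G etaK).
have -> : dot (tperm a b) rho - rho = e * tbar F G a - e * tbar F G b.
  rewrite -mulrBr; apply/val_inj/ffunP => v.
  by have := heta v; rewrite !ffunE.
by apply: rpredB; exact: mul_tbar_tideal.
Qed.

(** * Homogeneous components and the ideal of the [tbar i] *)

Lemma pihomog_lrmorph (phi : {lrmorphism P -> P}) d (p : P) :
  (forall i, phi 'X_i \is 1.-homog) ->
  phi (pihomog mdeg d p) = pihomog mdeg d (phi p).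
Proof.
move=> hX; elim/mpolyind: p => [|c m p _ _ IHp]; first by rewrite !raddf0.
rewrite !raddfD /= IHp !linearZ /= pihomogX; congr (_ *: _ + _).
have hm : phi 'X_[m] \is (mdeg m).-homog.
  by apply: lrmorph_dhomog; rewrite // dhomogX.
case: ifP => [/eqP <-|/negbT nd]; first by rewrite pihomog_dE.
by rewrite raddf0 (pihomog_ne0 nd hm).
Qed.

Lemma pihomog_spline (G : sgraph n) d (rho : funS) :
  rho \in is_spline G -> [ffun w => pihomog mdeg d (rho w)] \in is_spline G.
Proof.
move=> /is_spline_identifyP h; apply/is_spline_identifyP => w i j Gij.
have hX l : identify (w i) (w j) ('X_l : P) \is 1.-homog.
  by rewrite identifyX; case: ifP => _; rewrite dhomogX /= mdeg1.
by rewrite !ffunE !(pihomog_lrmorph _ _ hX) /= h.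
Qed.

(** In degree [d.+1] the coefficients of the [tbar i] can be replaced by their components of degree
    [d], which are splines on the complete graph by [low_degree_is_spline_complete]. *)
Lemma tideal_is_spline_complete (G : sgraph n) d (rho : spline F G) :
  k_connected G d.+1 -> rho \in homog_spline d.+1 -> rho \in @tideal F n G ->
  (rho : funS) \in is_spline K.
Proof.
move=> kG /forallP hrho /asboolP[c rhoE].
have -> : (rho : funS) =
    \sum_i [ffun w => pihomog mdeg d (c i w)] * [ffun _ => 'X_i].
  apply/ffunP => w; rewrite -(pihomog_dE (hrho w)) rhoE.
  have -> : spline_val (\sum_i c i * tbar F G i) =
      \sum_i (c i : funS) * [ffun=> 'X_i].
    by rewrite [LHS](raddf_sum (val : spline F G -> funS)).
  rewrite !sum_ffunE raddf_sum /=; apply: eq_bigr => i _.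
  by rewrite !ffunE pihomogMX.
apply: rpred_sum => i _; apply: rpredM; last exact: const_spline_subproof.
apply: (low_degree_is_spline_complete kG (ltnSn d)) => [w|].
  by rewrite ffunE pihomogP.
exact/pihomog_spline/spline_valP.
Qed.

(** * Splines built from a vertex cut *)

Definition cut_fun (A B : {set 'I_n}) (p : 'I_n) : funS :=
  [ffun w : 'S_n =>
     if w^-1%g p \in B then \prod_(a in A) ('X_(w a) - 'X_p) else 0].

Lemma cut_fun_homog A B p w : cut_fun A B p w \is #|A|.-homog.
Proof.
rewrite ffunE; case: ifP => _; last exact: dhomog0.
rewrite -sum1_card; apply: (big_ind2 (fun (a : P) e => a \is e.-homog)).
- exact: dhomog1.
- by move=> a e b f; exact: dhomogM.
- by move=> a _; rewrite rpredB // dhomogX /= mdeg1.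
Qed.

Lemma dot_cut_fun A B p w : dot_fun w (cut_fun A B p) = cut_fun A B (w p).
Proof.
apply/ffunP => v; rewrite !ffunE /pcomp invMg invgK permM.
case: ifP => _; last by rewrite raddf0.
rewrite rmorph_prod; apply: eq_bigr => a _.
by rewrite raddfB /= !msymU permM permKV.
Qed.

(** Passing from [w] to [v] moves the position of [p] at most along the edge. If this leaves or
    enters [B], the endpoint outside [B] lies in [A] and its factor vanishes after identification;
    otherwise the two values agree factor by factor or are both zero. *)
Lemma cut_fun_spline (G : sgraph n) (A B : {set 'I_n}) p :
  (forall x y, x \in B -> G x y -> y \in A :|: B) ->
  cut_fun A B p \in is_spline G.
Proof.
move=> hB; apply/is_spline_identifyP => w i j Gij.
set v := pcomp w _; set sigma := identify _ _.
have sigmav z : sigma 'X_(v z) = sigma 'X_(w z).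
  rewrite pcompE; case: tpermP => [->|->|//].
    by rewrite /sigma identify_eqX.
  by rewrite /sigma -identify_eqX.
have sigma0 (u : 'S_n) q b : b \in A -> sigma 'X_(u b) = sigma 'X_q ->
    sigma (\prod_(a in A) ('X_(u a) - 'X_q)) = 0.
  move=> bA e; rewrite /sigma rmorph_prod (bigD1 b) //= raddfB /= -/sigma e.
  by rewrite subrr mul0r.
set x := w^-1%g p; set y := v^-1%g p.
have yE : y = tperm i j x by rewrite /y /v /pcomp invMg tpermV permM.
have wx : w x = p by rewrite permKV.
have vy : v y = p by rewrite permKV.
rewrite !ffunE -/x -/y.
have [exy|nxy] := eqVneq x y.
  rewrite -exy; case: ifP => _; last by rewrite /sigma !raddf0.
  by rewrite /sigma !rmorph_prod; apply: eq_bigr => a _;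
    rewrite !raddfB /= -/sigma sigmav.
have Gxy : G x y.
  by move: nxy; rewrite yE; case: tpermP => [->|->|]; rewrite ?eqxx // adj_sym.
have [xB|xB] := boolP (x \in B); have [yB|yB] := boolP (y \in B) => //.
- by rewrite /sigma !rmorph_prod; apply: eq_bigr => a _;
    rewrite !raddfB /= -/sigma sigmav.
- have := hB x y xB Gxy; rewrite inE (negPf yB) orbF [sigma 0]raddf0 => yA.
  by apply: sigma0 yA _; rewrite -sigmav vy.
- have := hB y x yB; rewrite adj_sym inE (negPf xB) orbF [sigma 0]raddf0.
  move=> /(_ Gxy) xA.
  by symmetry; apply: sigma0 xA _; rewrite sigmav wx.
Qed.

(** The condition fails at the identity for the pair [x], [y]: the cut function is zero at
    [tperm x y], while its value at the identity keeps nonzero factors after ['X_y] becomes ['X_x].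
    The summand [rho] allows both [0] and another cut function. *)
Lemma cut_fun_not_complete (A B : {set 'I_n}) (x y : 'I_n) (rho : funS) :
  x \notin A -> y \notin A -> x \in B -> y \notin B ->
  rho 1%g = 0 -> rho (tperm x y) = 0 ->
  rho - cut_fun A B x \notin is_spline K.
Proof.
move=> xA yA xB yB rho1 rhot; apply/negP => /is_spline_identifyP/(_ 1%g x y).
have nxy : x != y by apply: contraNneq yB => <-.
have -> : pcomp 1%g (tperm x y) = tperm x y by rewrite /pcomp mulg1.
move=> /(_ nxy); rewrite !perm1 !ffunE rho1 rhot tpermV tpermL.
rewrite (negPf yB) subrr raddf0 invg1 perm1 xB sub0r raddfN /= rmorph_prod.
apply/eqP; rewrite oppr_eq0; apply/prodf_neq0 => a aA.
rewrite perm1 raddfB /= !identifyX (negPf nxy).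
have [eay|_] := eqVneq a y; first by rewrite -eay aA in yA.
by rewrite subr_eq0; apply: contraNneq xA => /mpolyXU_inj <-.
Qed.
End PolynomialSplines.

(** * Finite-dimensional linear algebra and separating sets *)

Lemma linear_inj_surj (F : fieldType) (U : lmodType F) (W : vectType F)
    (e : {linear U -> W}) (g : {linear U -> U}) :
  injective e -> injective g -> forall u, exists v, g v = u.
Proof.
move=> e_inj g_inj u.
(* In a nontrivial relation between [u], [g u], [g (g u)] and so on, injectivity of [g] strips zero
   leading coefficients; once the coefficient of [u] is nonzero, the relation exhibits [u] as a
   value of [g]. *)
have dep_surj m (k : nat -> F) : \sum_(i < m) k i *: iter i g u = 0 ->
    (exists2 i, (i < m)%N & k i != 0) -> exists v, g v = u.
  elim: m k => [|m IHm] k; first by move=> _ [].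
  rewrite big_ord_recl /=.
  have -> : \sum_(i < m) k (bump 0 i) *: g (iter i g u) =
      g (\sum_(i < m) k i.+1 *: iter i g u).
    by rewrite linear_sum; apply: eq_bigr => i _; rewrite linearZ.
  set s := \sum_(i < m) _; have [k0|k0] := eqVneq (k 0%N) 0.
    rewrite k0 scale0r add0r -(raddf0 g) => /g_inj s0 [[|i] lt_im ki].
      by rewrite k0 eqxx in ki.
    by apply: (IHm (k \o succn)) => //; exists i.
  move=> /eqP; rewrite addr_eq0 => /eqP us _; exists (- (k 0%N)^-1 *: s).
  by rewrite linearZ /= scaleNr -scalerN -us scalerA mulVf // scale1r.
(* One more iterate than the dimension of [W] forces a relation between the images under [e]. *)
pose N := (\dim {:W}).+1; pose X := [tuple e (iter i g u) | i < N].
have nfree : ~~ free X.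
  by rewrite /free size_tuple neq_ltn ltnS dimvS ?subvf.
apply: contrapT => nv; move/negP: nfree; apply; apply/freeP => k k0 i.
apply/eqP; apply: contrapT => /negP ki; apply: nv.
apply: (dep_surj N (fun j => k (inord j))); last first.
  by exists i => //; rewrite inord_val.
apply: e_inj; rewrite raddf0 linear_sum -[RHS]k0; apply: eq_bigr => j _.
by rewrite linearZ -tnth_nth tnth_mktuple /= inord_val.
Qed.

(** For [x] and [y] not joined off [A], the component of [x] there serves as [B]: an edge leaving it
    can only end in [A]. *)
Lemma disconnecting_set n (G : sgraph n) (A : {set 'I_n}) :
  ~ connected_off G A ->
  exists (B : {set 'I_n}) x y, [/\ x \notin A, y \notin A, x \in B, y \notin B &
    forall u v, u \in B -> G u v -> v \in A :|: B] /\ [disjoint A & B].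
Proof.
set e := [rel u v | [&& u \notin A, v \notin A & G u v]].
move=> nconn; have [x [y [xA yA nxy]]] :
    exists x y, [/\ x \notin A, y \notin A & ~~ connect e x y].
  apply: contrapT => h; apply: nconn => x y; rewrite !inE => xA yA.
  by apply: contrapT => /negP nxy; apply: h; exists x, y.
pose B := [set z | connect e x z].
have BA z : z \in B -> z \notin A.
  rewrite inE => /connectP[s s_path ->]; elim: s (x) xA s_path => //=.
  move=> b s IHs a aA.
  by case/andP => /and3P[_ bA _]; exact: IHs.
exists B, x, y; split; last first.
  by rewrite disjoint_sym disjoint_subset; apply/subsetP => z /BA.
split=> //; rewrite ?inE ?connect0 // => u v uB Guv; rewrite !inE.
have [//|vA] := boolP (v \in A); move: (uB); rewrite inE => xu.
by apply: connect_trans xu (connect1 _); rewrite /= BA // vA.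
Qed.

(** * Graded pieces compared with those of the complete graph *)

Section GradedSplines.
Variables (F : fieldType) (n : nat).

Lemma cut_spline_graded (G : sgraph n) (A B : {set 'I_n}) p :
  (forall x y, x \in B -> G x y -> y \in A :|: B) ->
  exists2 rho : spline F G, rho \in homog_spline #|A| &
    spline_val rho = cut_fun F A B p.
Proof.
move=> hB; exists (Spline (cut_fun_spline F p hB)) => //.
by apply/forallP => w; exact: cut_fun_homog.
Qed.

Lemma graded_incl_val_subproof (G : sgraph n) d
    (rho : graded_spline F (complete_graph n) d) :
  Spline (is_spline_complete G (spline_valP rho)) \in homog_spline d.
Proof. by have := graded_spline_valP rho. Qed.

Definition graded_incl (G : sgraph n) d
    (rho : graded_spline F (complete_graph n) d) :
  graded_spline F G d := GradedSpline (graded_incl_val_subproof G rho).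

Lemma graded_incl_linear (G : sgraph n) d : linear (@graded_incl G d).
Proof. by move=> a x y; do 2!apply/val_inj. Qed.
HB.instance Definition _ (G : sgraph n) d :=
  GRing.isLinear.Build F _ _ *:%R (@graded_incl G d) (@graded_incl_linear G d).

Lemma graded_incl_inj (G : sgraph n) d : injective (@graded_incl G d).
Proof.
move=> x y /(congr1 (fun z => spline_val (graded_spline_val z))) /= e.
by do 2!apply/val_inj.
Qed.

(** Embeds the graded piece into a finite-dimensional space, as [linear_inj_surj] requires. *)
Definition graded_coeffs (G : sgraph n) d (rho : graded_spline F G d) :
    {ffun 'S_n * 'X_{1..n < d.+1} -> F^o} :=
  [ffun wm : 'S_n * 'X_{1..n < d.+1} => (rho wm.1)@_wm.2].

Lemma graded_coeffs_linear (G : sgraph n) d : linear (@graded_coeffs G d).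
Proof. by move=> a x y; apply/ffunP => wm; rewrite !ffunE mcoeffD mcoeffZ. Qed.
HB.instance Definition _ (G : sgraph n) d :=
  GRing.isLinear.Build F _ _ *:%R (@graded_coeffs G d)
    (@graded_coeffs_linear G d).

Lemma graded_coeffs_inj (G : sgraph n) d : injective (@graded_coeffs G d).
Proof.
move=> x y /ffunP exy; do 2!apply/val_inj; apply/ffunP => w; apply/mpolyP => m.
have [md|md] := eqVneq (mdeg m) d.
  have ltm : (mdeg m < d.+1)%N by rewrite md.
  by have := exy (w, BMultinom ltm); rewrite !ffunE.
have /forallP/(_ w) hx := graded_spline_valP x.
have /forallP/(_ w) hy := graded_spline_valP y.
by rewrite (dhomog_nemf_coeff hx md) (dhomog_nemf_coeff hy md).
Qed.

Definition graded_restr (G : sgraph n) d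
    (h : forall rho : spline F G, rho \in homog_spline d ->
       spline_val rho \in is_spline (complete_graph n))
    (rho : graded_spline F G d) : graded_spline F (complete_graph n) d :=
  @GradedSpline _ _ _ d (Spline (h _ (graded_spline_valP rho)))
    (graded_spline_valP rho).

Lemma graded_restr_linear G d h : linear (@graded_restr G d h).
Proof. by move=> a x y; do 2!apply/val_inj. Qed.
HB.instance Definition _ G d h :=
  GRing.isLinear.Build F _ _ *:%R (@graded_restr G d h) (graded_restr_linear h).

(** An abstract isomorphism followed by the inclusion of complete-graph splines is an injective
    endomorphism of a finite-dimensional space. It is therefore onto, and so is the inclusion. *)
Lemma isomorphic_graded_spline (G : sgraph n) d :
  isomorphic_lmod (graded_spline F G d) (graded_spline F (complete_graph n) d) <->
  (forall rho : spline F G, rho \in homog_spline d ->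
     spline_val rho \in is_spline (complete_graph n)).
Proof.
split=> [[f f_bij] rho hrho | h].
  have [|v hv] := @linear_inj_surj _ _ _ (@graded_coeffs G d)
    (@graded_incl G d \o f) (@graded_coeffs_inj G d) _ (GradedSpline hrho).
    by apply: inj_comp; [exact: graded_incl_inj|exact: bij_inj].
  by have /= <- := congr1 (fun z => spline_val (graded_spline_val z)) hv;
     exact: spline_valP.
by exists (graded_restr h), (@graded_incl G d) => x; do 2!apply/val_inj.
Qed.

(** * The equivalences with [k]-connectivity *)

Lemma k_connected_splineP (G : sgraph n) k :
  k_connected G k <->
  (forall d, (d < k)%N -> forall rho : spline F G, rho \in homog_spline d ->
     spline_val rho \in is_spline (complete_graph n)).
Proof.
split=> [kG d ltdk rho /forallP hrho | h A ltAk].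
  exact: low_degree_is_spline_complete kG ltdk hrho (spline_valP rho).
apply: contrapT => /disconnecting_set[B [x [y [[xA yA xB yB hB] _]]]].
have [rho hrho rhoE] := cut_spline_graded x hB.
have := @cut_fun_not_complete F n A B x y 0 xA yA xB yB.
rewrite !ffunE => /(_ erefl erefl).
by rewrite sub0r rpredN -rhoE (h _ ltAk _ hrho).
Qed.

Lemma k_connected_trivialP (G : sgraph n) k :
  connected_graph G ->
  k_connected G k <-> (forall d, (d < k)%N -> L_trivial_rep F G d).
Proof.
move=> connG; split=> [kG d ltdk w _ [rho hrho ->]|triv].
  rewrite LdotE; apply/eqP; rewrite Lpi_eq; apply: dot_sub_tideal.
  exact: (proj1 (k_connected_splineP G k) kG d).
(* Induction on [m] reduces to a cut [A] with exactly [m] elements, where all splines of degree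
   below [m] already live on the complete graph. *)
suff IH m : (m <= k)%N -> k_connected G m by exact: IH.
elim: m => [|m IHm] ltmk A; first by rewrite ltn0.
have mG := IHm (ltnW ltmk).
rewrite ltnS leq_eqVlt => /orP[/eqP cA|]; last exact: mG.
(* Connectedness of [G] excludes the empty cut, so some [a] in [A] is available. *)
have [A0|[a aA]] := set_0Vmem A; first by rewrite A0.
apply: contrapT => /disconnecting_set[B [x [y [[xA yA xB yB hB] dAB]]]].
have aB : a \notin B by rewrite (disjointFr dAB).
have [rho hrho rhoE] := cut_spline_graded x hB.
case: m cA mG hrho ltmk {IHm} => [|m] cA mG.
  by rewrite (cards0_eq cA) inE in aA.
rewrite cA => hrho ltmk.
(* [s] carries the cut spline of [x] to that of [a]. The latter vanishes at the identity and at
   [tperm x y], since both fix [a], which is outside [B]. *)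
pose s := tperm x a.
have dotE : spline_val (dot s rho) = cut_fun F A B a.
  by rewrite /= rhoE dot_cut_fun tpermL.
have hdot : dot s rho \in homog_spline m.+1.
  by apply/forallP => w; rewrite dotE -cA; exact: cut_fun_homog.
have : dot s rho - rho \in @tideal F n G.
  by rewrite -Lpi_eq -LdotE; apply/eqP/(triv _ ltmk); exists rho.
move/(tideal_is_spline_complete mG) => /(_ (rpredB hdot hrho)).
apply/negP.
have -> : spline_val (dot s rho - rho) = cut_fun F A B a - cut_fun F A B x.
  by rewrite -dotE -rhoE; apply: (raddfB (val : spline F G -> _)).
apply: (cut_fun_not_complete xA yA xB yB);
  rewrite ffunE ?invg1 ?perm1 ?(negPf aB) //.
by rewrite tpermV tpermD ?(negPf aB) //; apply: contraTneq aA => <-.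
Qed.
End GradedSplines.

(* R ranges over the models of the real numbers, so R[i] is the field of
   complex numbers. *)
Theorem theoremC (R : realType) (n : nat) (G : sgraph n) (k : nat)
    (connG : connected_graph G) (k_ge1 : (1 <= k)%N) :
  (k_connected G k <->
     (forall d : nat, (d < k)%N -> L_trivial_rep R[i] G d))
  /\
  (k_connected G k <->
     (forall d : nat, (d < k)%N ->
        isomorphic_lmod (graded_spline R[i] G d)
                        (graded_spline R[i] (complete_graph n) d))).
Proof.
split; first exact: k_connected_trivialP.
rewrite (k_connected_splineP R[i] G k).
by split=> h d ltdk; have := h d ltdk; rewrite isomorphic_graded_spline.
Qed.
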